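(* Let $m\ge 7$ be odd and let $n$ satisfy $$\binom{m-1}{\lfloor m/2\rfloor-1}+m-3\lfloor m/2\rfloor<n\le\binom{m-1}{\lfloor m/2\rfloor-1}.$$ Then $CAN(3,n+1,2)\ge 2\,CAN(2,n,2)+1$.
   Context: A binary $t$-covering array of size $m$ and degree $n$ is an $m\times n$ matrix with entries in $\{0,1\}$ such that for any $t$ distinct columns, all $2^t$ binary vectors of length $t$ occur at least once as the restriction of some row to those columns. $CAN(t,n,2)$ denotes the minimum $m$ such that a binary $t$-covering array of size $m$ and degree $n$ exists. *)

(* Defs.v *)
From mathcomp Require Import all_boot all_order all_algebra.

Set Implicit Arguments.
Unset Strict Implicit.
Unset Printing Implicit Defensive.

(* [c] lists t distinct columns, [v] is a binary vector of length t. *)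
Definition covering_array (t m n : nat) (A : 'M[bool]_(m, n)) : bool :=
  [forall c : {ffun 'I_t -> 'I_n}, injectiveb c ==>
    [forall v : {ffun 'I_t -> bool},
      [exists i : 'I_m, [forall k : 'I_t, A i (c k) == v k]]]].

Definition has_covering_array (t n m : nat) : bool :=
  [exists A : 'M[bool]_(m, n), covering_array t A].

(* Witness: the array whose rows are all 2 ^ n binary vectors. *)
Lemma has_covering_array_ex (t n : nat) : exists m, has_covering_array t n m.
Proof.
exists #|{ffun 'I_n -> bool}|; apply/existsP.
exists (\matrix_(i, j) (enum_val i : {ffun 'I_n -> bool}) j)%R.
apply/forallP => c; apply/implyP => /injectiveP c_inj; apply/forallP => v.
pose f := [ffun j : 'I_n => [exists k, (c k == j) && v k]].
apply/existsP; exists (enum_rank f); apply/forallP => k.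
rewrite mxE enum_rankK ffunE; apply/eqP.
apply/existsP/idP => [[l /andP[/eqP/c_inj -> //]]|vk].
by exists k; rewrite eqxx.
Qed.

(* CAN(t, n, 2) *)
Definition CAN (t n : nat) : nat := ex_minn (has_covering_array_ex t n).

(* Main.v *)
(* Write m = 2k + 1 and C = binom(2k, k - 1). All k-subsets of {1, .., m} through a
   fixed point give CAN(2, n) <= m, so it suffices to exclude a 3-covering array
   with n + 1 columns and at most 2m rows. For a column i, the rows where i is 0
   and those where i is 1 both form 2-covering arrays on the n other columns.
   Complementing the columns of more than k ones in such an array on at most m
   rows yields an intersecting antichain of sets of size at most k in an m-set.
   The Erdos-Ko-Rado theorem, with an upper shadow estimate for the sets of size
   less than k, and n > C - k + 1 then force exactly m rows and columns with k or
   k + 1 ones. Hence the array has exactly 2m rows, and its n + 1 columns are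
   balanced +-1 vectors with pairwise inner products +-2, i.e. equiangular lines.
   The relative bound on equiangular lines gives (n + 1) k <= (k + 1)(4k + 1), a
   contradiction for k >= 4. For k = 3 there would be 15 vectors of length 14; the
   3-covering property makes the sum t of the entries of a triple product satisfy
   t^2 = 8 + (product of the three inner products), which contradicts a third
   moment identity for the Gram matrix of the rows. *)
Require Import Defs.
From mathcomp Require Import all_boot all_order all_algebra all_fingroup.
From mathcomp Require Import zify ring.
Set Implicit Arguments.
Unset Strict Implicit.
Unset Printing Implicit Defensive.

(** * Permutations, cyclic arcs and the Erdos-Ko-Rado theorem *)

(** List [A] followed by its complement, do the same for [B], and match the lists position by
    position. *)
Lemma exists_perm_imset (T : finType) (A B : {set T}) :
  #|A| = #|B| -> exists s : {perm T}, s @: A = B.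
Proof.
move=> eqAB.
have: exists f : T -> T, injective f /\ f @: A = B.
  case: (set_0Vmem [set: T]) => [T0|[x0 _]].
    by exists id; split=> //; apply/setP => x; have := in_setT x; rewrite T0 inE.
  pose s C := enum (C : {set T}) ++ enum (~: C).
  have mem_s C x : x \in s C by rewrite mem_cat !mem_enum inE orbN.
  have uniq_s C : uniq (s C).
    rewrite cat_uniq !enum_uniq andbT /=.
    by apply/hasPn => x; rewrite !mem_enum inE.
  have size_s C : size (s C) = #|T| by rewrite size_cat -!cardE cardsC.
  pose f x := nth x0 (s B) (index x (s A)).
  have lt_s C D x : index x (s C) < size (s D) by rewrite size_s -(size_s C) index_mem.
  have f_inj : injective f.
    move=> x y /eqP; rewrite nth_uniq // => /eqP e.
    by rewrite -(nth_index x0 (mem_s A x)) e nth_index.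
  exists f; split=> //; apply/eqP; rewrite eqEcard card_imset // eqAB leqnn andbT.
  apply/subsetP => _ /imsetP[x xA ->].
  have: index x (s A) < #|B| by rewrite index_cat mem_enum xA -eqAB cardE index_mem mem_enum.
  rewrite cardE /f nth_cat => lt; rewrite lt -mem_enum; exact: mem_nth.
case=> f [f_inj <-]; exists (perm f_inj).
by apply: eq_imset => x; rewrite permE.
Qed.

(** If [u] maps [A] to [C] and [v] maps [B] to [D], then [s] corresponds to [u^-1 * s * v]. Hence,
    in the cycle argument, every pair of an arc and a [k]-set is counted equally often. *)
Lemma card_perm_imset (T : finType) (A B C D : {set T}) :
  #|A| = #|C| -> #|B| = #|D| ->
  #|[set s : {perm T} | s @: A == B]| = #|[set s : {perm T} | s @: C == D]|.
Proof.
move=> /exists_perm_imset[u <-] /exists_perm_imset[v <-].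
rewrite -(card_imset (mem [set s : {perm T} | s @: A == B])
  (inj_comp (mulgI u^-1%g) (mulIg v))).
apply: eq_card => s; apply/imsetP/idP => [[w]|].
  rewrite !inE => /eqP <- ->; rewrite -!imset_comp; apply/eqP/eq_imset => x /=.
  by rewrite !permM permK.
rewrite inE => /eqP e; exists (u * s * v^-1)%g; last by rewrite /= mulgKV mulKg.
rewrite inE -(inj_eq (imset_inj (@perm_inj _ v))) -e -!imset_comp.
by apply/eqP/eq_imset => x /=; rewrite !permM permKV.
Qed.

Definition arc k (i : 'I_k.*2.+1) : {set 'I_k.*2.+1} := [set x | (x - i)%R < k].

Lemma card_arc k i : #|arc (k:=k) i| = k.
Proof.
have -> : arc i = (fun y => (y + i)%R) @: [set y : 'I_k.*2.+1 | y < k].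
  apply/setP => x; apply/idP/imsetP => [|[y]]; rewrite !inE.
    by move=> lt; exists (x - i)%R; rewrite ?inE // GRing.subrK.
  by move=> lt ->; rewrite GRing.addrK.
rewrite card_imset; last exact: GRing.addIr.
rewrite -sum1dep_card (big_ord_narrow_cond (P := xpredT)) ?sum1_card ?card_ord //.
by lia.
Qed.

(** Modulo 2k + 1, subtracting k from a residue y < k gives y + k + 1, which is not below k. *)
Lemma disjoint_arc k i : [disjoint arc i & arc (i + inord k : 'I_k.*2.+1)%R].
Proof.
rewrite disjoint_subset; apply/subsetP => x; rewrite !inE -leqNgt => lt.
rewrite GRing.opprD GRing.addrA; move: (x - i)%R lt => y lt /=.
rewrite inordK; last by lia.
rewrite modnDmr; have := ltn_ord y => _.
rewrite modn_small; lia.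
Qed.

(* Katona's cycle argument: [arc i] and [arc (i + k)] are disjoint, so an
   intersecting family contains at most [k] of the [2k + 1] arcs. *)
Lemma erdos_ko_rado k (F : {set {set 'I_k.*2.+1}}) : 0 < k ->
  {in F, forall A : {set _}, #|A| = k} ->
  {in F &, forall A B : {set _}, ~~ [disjoint A & B]} ->
  #|F| <= 'C(k.*2, k.-1).
Proof.
move=> k_gt0 Fk Fint; set m := k.*2.+1.
pose c := #|[set s : {perm 'I_m} | s @: arc ord0 == arc ord0]|.
have c_gt0 : 0 < c.
  apply/card_gt0P; exists 1%g; rewrite inE; apply/eqP/setP => x.
  apply/imsetP/idP => [[y ? ->]|xA]; first by rewrite perm1.
  by exists x; rewrite ?perm1.
have cE i (A : {set 'I_m}) : #|A| = k -> \sum_(s : {perm 'I_m}) (s @: arc i == A) = c.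
  move=> Ak; transitivity #|[set s : {perm 'I_m} | s @: arc i == A]|.
    by rewrite -sum1dep_card [RHS]big_mkcond.
  by apply: card_perm_imset; rewrite ?card_arc.
have sumE (G : {set {set 'I_m}}) : {in G, forall A : {set _}, #|A| = k} ->
    \sum_(s : {perm 'I_m}) \sum_i (s @: arc i \in G) = m * (#|G| * c).
  move=> Gk; rewrite exchange_big /=.
  rewrite (eq_bigr (fun=> #|G| * c)) ?sum_nat_const ?card_ord // => i _.
  rewrite (eq_bigr (fun s : {perm 'I_m} => \sum_(A in G) (s @: arc i == A))).
    rewrite exchange_big /= (eq_bigr (fun=> c)) ?sum_nat_const // => A /Gk.
    exact: cE.
  move=> s _; case: (boolP (_ \in G)) => sG.
    rewrite (bigD1 (s @: arc i)) ?eqxx //= big1 // => A /andP[_ neq].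
    by rewrite eq_sym (negPf neq).
  by rewrite big1 // => A AG; case: eqP => // e; move: sG; rewrite e AG.
(* For the family of all [k]-sets every arc counts, which determines [c] without factorials. *)
pose U := [set A : {set 'I_m} | #|A| == k].
have Uk : {in U, forall A : {set _}, #|A| = k} by move=> A; rewrite inE => /eqP.
have cardU : #|U| = 'C(m, k) by rewrite card_draws ?card_ord.
have cnt (s : {perm 'I_m}) : \sum_i (s @: arc i \in F) <= k.
  (* Indices [i] and [i + k] never both count, so twice the sum is at most the odd number 2k + 1. *)
  have le : \sum_i (s @: arc i \in F) + \sum_i (s @: arc i \in F) <= m.
    rewrite {2}(reindex_inj (@GRing.addIr _ (inord k : 'I_m))) /=.
    rewrite -big_split /= -[leqRHS]card_ord -sum1_card; apply: leq_sum => i _.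
    case: (boolP (s @: arc i \in F)) => s1; last exact: leq_b1.
    case: (boolP (_ \in F)) => s2 //; have := Fint _ _ s1 s2.
    by rewrite imset_disjoint ?disjoint_arc //; exact: perm_inj.
  by move: le; rewrite /m; lia.
have: \sum_(s : {perm 'I_m}) \sum_i (s @: arc i \in F) <= #|{perm 'I_m}| * k.
  apply: (@leq_trans (\sum_(s : {perm 'I_m}) k)); last by rewrite sum_nat_const.
  by apply: leq_sum => s _; apply: cnt.
rewrite sumE //; have := sumE _ Uk.
under eq_bigr => s _.
  rewrite (eq_bigr (fun=> 1)) => [|i _]; last first.
    by rewrite inE card_imset ?card_arc ?eqxx //; apply: perm_inj.
  rewrite sum1_card card_ord; over.
rewrite sum_nat_const cardU => e le.
rewrite -(leq_pmul2l (ltn0Sn k.*2)) -/m.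
have := mul_bin_diag k.*2.+1 k.-1; rewrite prednK //= -/m => ->.
rewrite -(leq_pmul2r c_gt0) -(leq_pmul2l (ltn0Sn k.*2)) -/m.
rewrite -[m * #|F| * c]mulnA (leq_trans (leq_mul (leqnn m) le)) //.
by rewrite mulnA [m * #|_|]mulnC e; lia.
Qed.

(** * Upper shadows and intersecting antichains *)

Definition upsets (T : finType) (A : {set T}) : {set {set T}} :=
  [set B : {set T} | (A \subset B) && (#|B| == #|A|.+1)].

Lemma card_upsets (T : finType) (A : {set T}) : #|upsets A| = #|T| - #|A|.
Proof.
have -> : upsets A = [set x |: A | x in ~: A].
  apply/setP => B; apply/idP/imsetP => [|[x]]; rewrite !inE.
    case/andP=> AB /eqP cB.
    have : 0 < #|B :\: A| by rewrite cardsD (setIidPr AB) cB subSnn.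
    case/card_gt0P=> x /setDP[xB xA]; exists x; rewrite ?inE //.
    apply/esym/eqP; rewrite eqEcard cB cardsU1 xA leqnn andbT.
    by rewrite subUset sub1set xB.
  by move=> xA ->; rewrite subsetUr cardsU1 xA add1n eqxx.
rewrite card_in_imset => [|x y]; first by rewrite cardsCs setCK.
rewrite !inE => xA yA /setP/(_ x); rewrite !inE eqxx (negPf xA) orbF.
by rewrite orbF => /esym/eqP.
Qed.

Definition upper_shadow (T : finType) (F : {set {set T}}) : {set {set T}} :=
  \bigcup_(A in F) upsets A.

(* All upsets of a member [A0] lie in the shadow; every other member shares at
   most one upset with [A0], so it keeps at least as many of them as an upset
   has subsets of size [r], and double counting applies away from [A0]. *)
Lemma card_upper_shadow (T : finType) (F : {set {set T}}) r :
  r.*2.+2 <= #|T| -> F != set0 -> {in F, forall A : {set T}, #|A| = r} ->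
  #|F| + (#|T| - r).-1 <= #|upper_shadow F|.
Proof.
move=> le_rT /set0Pn[A0 A0F] Fr; set N := upper_shadow F.
have subN A : A \in F -> upsets A \subset N by move=> AF; apply: bigcup_sup AF.
have cU A : A \in F -> #|upsets A| = #|T| - r by move=> AF; rewrite card_upsets Fr.
rewrite -(cardsID (upsets A0) N) (setIidPr (subN _ A0F)) (cU _ A0F).
rewrite (cardsD1 A0) A0F.
suff: #|F :\ A0| <= #|N :\: upsets A0| by lia.
have deg A : A \in F :\ A0 -> r.+1 <= #|upsets A :\: upsets A0|.
  rewrite !inE => /andP[neq AF]; rewrite cardsD (cU _ AF).
  have : #|upsets A :&: upsets A0| <= 1.
    rewrite -(cards1 (A :|: A0)); apply/subset_leq_card/subsetP => B.
    rewrite !inE (Fr _ AF) => /andP[/andP[AB cB] /andP[A0B _]].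
    rewrite eq_sym eqEcard subUset AB A0B (eqP cB) /=.
    rewrite -(Fr _ AF); apply: proper_card; rewrite properE subsetUl subUset.
    rewrite subxx /=; apply: contra neq => sub.
    by rewrite eq_sym eqEcard sub !Fr /=.
  by lia.
rewrite -(leq_pmul2r (ltn0Sn r)) -[leqLHS]sum_nat_const.
apply: (@leq_trans (\sum_(A in F :\ A0) #|upsets A :\: upsets A0|)).
  exact: leq_sum.
have -> : \sum_(A in F :\ A0) #|upsets A :\: upsets A0| =
    \sum_(A in F :\ A0) \sum_(B in N :\: upsets A0) (B \in upsets A).
  apply: eq_bigr => A; rewrite 2!inE => /andP[_ AF].
  rewrite -[in RHS]big_mkcondr /= sum1dep_card; apply: eq_card => B.
  rewrite !inE; have /subsetP/(_ B) := subN _ AF; rewrite !inE.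
  by case: (_ && (#|B| == #|A|.+1)) => [->|]; rewrite ?andbF ?andbT.
rewrite exchange_big -sum_nat_const; apply: leq_sum => B.
case/setDP=> /bigcupP[A AF AB] _; move: AB; rewrite inE (Fr _ AF) => /andP[_ /eqP cB].
rewrite -[leqLHS]big_mkcondr /= sum1dep_card -[leqRHS]binSn -cB -cards_draws.
apply/subset_leq_card/subsetP => C; rewrite !inE.
by case/andP=> /andP[_ CF] /andP[-> _]; rewrite (Fr _ CF) /=.
Qed.

(* Replacing the smallest members, if they have fewer than [k] elements, by
   their upper shadow gains at least [k + 1] members. *)
Lemma intersecting_antichain_bound k (F : {set {set 'I_k.*2.+1}}) : 0 < k ->
  {in F, forall A : {set _}, #|A| <= k} ->
  {in F &, forall A B : {set _}, A \subset B -> A = B} ->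
  {in F &, forall A B : {set _}, ~~ [disjoint A & B]} ->
  #|F| + k.+1 * [exists A in F, #|A| < k] <= 'C(k.*2, k.-1).
Proof.
move=> k_gt0.
(* Induction on how far below [k] the sizes may lie. *)
suff gen d : {in F, forall A : {set _}, k - d <= #|A| <= k} ->
  {in F &, forall A B : {set _}, A \subset B -> A = B} ->
  {in F &, forall A B : {set _}, ~~ [disjoint A & B]} ->
  #|F| + k.+1 * [exists A in F, #|A| < k] <= 'C(k.*2, k.-1).
  by move=> Fk; apply: (gen k) => A /Fk; rewrite subnn.
elim: d F => [|d IH] F Fk Fanti Fint.
  have Fk' : {in F, forall A : {set _}, #|A| = k}.
    by move=> A /Fk; rewrite subn0 -eqn_leq => /eqP.
  case: existsP => [[A /andP[/Fk' ->]]|_]; first by rewrite ltnn.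
  by rewrite muln0 addn0 erdos_ko_rado.
pose r := k - d.+1; pose L := [set A in F | #|A| == r].
have [L0|Ln0] := eqVneq L set0.
  apply: IH => // A AF; have /andP[le1 ->] := Fk _ AF; rewrite andbT.
  move: le1; rewrite leq_eqVlt => /orP[/eqP e|]; last by lia.
  by have := in_set0 A; rewrite -L0 inE AF -e eqxx.
have [d_lt|d_ge] := ltnP d k; last first.
  by apply: IH => // A AF; have := Fk _ AF; lia.
have Lr : {in L, forall A : {set _}, #|A| = r} by move=> A; rewrite inE => /andP[_ /eqP].
have LF A : A \in L -> A \in F by rewrite inE => /andP[].
have shadowP B : B \in upper_shadow L -> exists2 A, A \in L & A \subset B /\ #|B| = r.+1.
  case/bigcupP=> A AL; rewrite inE (Lr _ AL) => /andP[AB /eqP cB].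
  by exists A.
have FN : [disjoint F :\: L & upper_shadow L].
  rewrite disjoint_subset; apply/subsetP => B /setDP[BF _]; rewrite inE.
  apply/negP => /shadowP[A AL [AB cB]].
  by have := Lr _ AL; rewrite (Fanti _ _ (LF _ AL) BF AB) cB; lia.
pose F' := (F :\: L) :|: upper_shadow L.
(* Each member of [F'] contains one of [F] and has more than [r] elements; both conditions on [F]
   pass to [F'] this way. *)
have F'P B : B \in F' -> exists2 A, A \in F & A \subset B /\
    (B = A /\ r < #|B| \/ A \in L /\ #|B| = r.+1).
  rewrite inE => /orP[/setDP[BF BL]|/shadowP[A AL [AB cB]]].
    exists B => //; split=> //; left; split=> //.
    move: BL; rewrite inE BF andTb => ne; have := Fk _ BF; rewrite /r in ne *; lia.
  by exists A; [apply: LF | split=> //; right].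
have: #|F'| + k.+1 * [exists A in F', #|A| < k] <= 'C(k.*2, k.-1).
  apply: IH => [B /F'P[A AF [_ [[-> lt]|[_ ->]]]]|B B' BF' B'F' sub|B B' ].
  - by have := Fk _ AF; move: lt; rewrite /r; lia.
  - by rewrite /r; lia.
  - case/F'P: BF' (BF') => A AF [AB hB] BF'; case/F'P: B'F' (B'F') => A' A'F [A'B' hB'] B'F'.
    have eqc : #|B'| <= #|B| -> B = B' by move=> le; apply/eqP; rewrite eqEcard sub.
    case: hB' => [[eB' lt']|[A'L cB']].
      rewrite eB' in sub eqc *; have AA' := Fanti _ _ AF A'F (subset_trans AB sub).
      case: hB => [[-> //]|[AL cB]].
      by apply: eqc; rewrite -AA' (Lr _ AL) cB.
    apply: eqc; rewrite cB'; case: hB => [[_ //]|[_ ->]] //.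
  move=> /F'P[A AF [AB _]] /F'P[A' A'F [A'B' _]].
  apply: contra (Fint _ _ AF A'F) => dis.
  exact: disjointWl AB (disjointWr A'B' dis).
(* As [r < k], the gain 2k - r is at least k + 1 and pays for the indicator of [F]. *)
have := @card_upper_shadow _ L r; rewrite card_ord => /(_ _ Ln0 Lr).
have -> : #|F'| = #|F :\: L| + #|upper_shadow L|.
  by rewrite cardsU (disjoint_setI0 FN) cards0 subn0.
have -> : #|F :\: L| = #|F| - #|L|.
  by rewrite cardsD (setIidPr _) //; apply/subsetP.
have : #|L| <= #|F| by apply/subset_leq_card/subsetP.
move=> leLF /(_ ltac:(rewrite /r; lia)); rewrite /r => grow.
by case: [exists A in F, _]; lia.
Qed.

(** * Binomial estimates and qualitatively independent sets *)

Lemma leq_bin n i : 0 < i < n -> n <= 'C(n, i).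
Proof.
elim: n i => // n IH [//|i] /andP[_].
rewrite ltnS leq_eqVlt => /orP[/eqP <-|lt]; first by rewrite binSn.
have bin_i : 0 < 'C(n, i) by rewrite bin_gt0; lia.
by rewrite binS; have := IH i.+1 lt; lia.
Qed.

(** By Pascal's rule 2C(2k, k-1) - C(2k, k) = 2C(2k-1, k-2), which is at least 2(2k-1). *)
Lemma central_bin k : 2 < k -> 'C(k.*2, k) + k.*2 < ('C(k.*2, k.-1)).*2 + 4.
Proof.
case: k => [|[|k]] // k_gt0; have -> : k.+2.*2 = (k.*2.+3).+1 by lia.
rewrite (binS k.*2.+3 k.+1) [k.+2.-1]/= (binS k.*2.+3 k) -(@bin_sub k.*2.+3 k.+2); last by lia.
have -> : k.*2.+3 - k.+2 = k.+1 by lia.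
by have := @leq_bin k.*2.+3 k; lia.
Qed.

(** The smaller of each [S j] and its complement, [N j], form an intersecting antichain. With this
    many members the surcharge k + 1 leaves no room for a set of fewer than [k] points. *)
Lemma qualitatively_independent_card (J : finType) k
    (S : J -> {set 'I_k.*2.+1}) : 2 < k -> 'C(k.*2, k.-1) + 2 <= #|J| + k ->
  (forall i j, i != j -> forall a b, exists x, (x \in S i) = a /\ (x \in S j) = b) ->
  forall j, k <= #|S j| <= k.+1.
Proof.
move=> k_gt2 leJ indep.
pose N j := [set x | (x \in S j) == (#|S j| <= k)].
have NE j : N j = if #|S j| <= k then S j else ~: S j.
  by apply/setP => x; rewrite inE; case: ifP; rewrite ?inE; case: (x \in _).
have sN j : #|N j| <= k.
  by rewrite NE; case: ifP => // ?; have := cardsC (S j); rewrite card_ord; lia.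
have J2 : 1 < #|J| by have := @leq_bin k.*2 k.-1; lia.
have other (j : J) : exists i, i != j.
  move: J2; rewrite (cardD1 j) inE ltnS => /card_gt0P[i]; rewrite !inE andbT.
  by exists i.
have Nanti i j : N i \subset N j -> i = j.
  move=> /subsetP sub; apply/eqP/negPn/negP => ne.
  have [x [xi xj]] := indep i j ne (#|S i| <= k) (~~ (#|S j| <= k)).
  by have := sub x; rewrite !inE xi xj eqxx; case: (_ <= _) => /(_ isT).
have Nint i j : ~~ [disjoint N i & N j].
  rewrite -setI_eq0; apply/set0Pn; have [<-|ne] := eqVneq i j.
    have [j' ne] := other i; rewrite eq_sym in ne.
    have [x [xi _]] := indep i j' ne (#|S i| <= k) true.
    by exists x; rewrite !inE xi eqxx.
  have [x [xi xj]] := indep i j ne (#|S i| <= k) (#|S j| <= k).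
  by exists x; rewrite !inE xi xj !eqxx.
have Ninj : injective N by move=> i j e; apply: Nanti; rewrite e.
have := @intersecting_antichain_bound k (N @: J) ltac:(lia).
rewrite card_imset // => bound j.
have {}bound : #|J| + k.+1 * [exists A in N @: J, #|A| < k] <= 'C(k.*2, k.-1).
  apply: bound => [_ /imsetP[i _ ->]|_ _ /imsetP[i _ ->] /imsetP[i' _ ->]|].
  - exact: sN.
  - by move=> /Nanti ->.
  - by move=> _ _ /imsetP[i _ ->] /imsetP[i' _ ->]; apply: Nint.
have : ~~ [exists A in N @: J, #|A| < k].
  by apply/negP => ex; move: bound; rewrite ex; lia.
rewrite negb_exists => /forallP/(_ (N j)); rewrite imset_f // andTb -leqNgt.
have := sN j; have := cardsC (S j); rewrite card_ord NE.
by case: ifP; lia.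
Qed.

(* If [P] misses a point, adding that point to every [S j] keeps the
   independence, so all [S j] have exactly [k] elements; being distinct even up
   to complementation in a set of [2k] points, they are too few. *)
Lemma qualitatively_independent_setT (J : finType) k (P : {set 'I_k.*2.+1})
    (S : J -> {set 'I_k.*2.+1}) : 2 < k -> 'C(k.*2, k.-1) + 2 <= #|J| + k ->
  (forall j, S j \subset P) ->
  (forall i j, i != j -> forall a b,
     exists2 x, x \in P & (x \in S i) = a /\ (x \in S j) = b) ->
  P = setT.
Proof.
move=> k_gt2 leJ SP indep; apply/eqP; rewrite -subTset; apply/subsetP => p _.
apply/negPn/negP => pP.
have pS j : p \notin S j by apply: contra pP; apply: subsetP (SP j) p.
have cS j : #|S j| = k.
  have := @qualitatively_independent_card J k S k_gt2 leJ.
  have := @qualitatively_independent_card J k (fun j => p |: S j) k_gt2 leJ.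
  move=> h1 h2; have {}h1 : k <= #|p |: S j| <= k.+1.
    apply: h1 => i i' ne a b; have [x xP [xi xi']] := indep i i' ne a b.
    by exists x; rewrite !inE xi xi'; case: eqP xP pP => // -> ->.
  have {}h2 : k <= #|S j| <= k.+1.
    apply: h2 => i i' ne a b; have [x xP [xi xi']] := indep i i' ne a b.
    by exists x.
  by move: h1 h2; rewrite cardsU1 pS; lia.
(* Each [S j] and its complement away from [p]: 2|J| distinct [k]-subsets of 2k points, against
   [central_bin]. *)
pose f (z : J * bool) := [set x | (x != p) && ((x \in S z.1) == z.2)].
have f_inj : injective f.
  move=> [i a] [j b] /setP e.
  have [eij|ne] := eqVneq i j.
    subst j; congr pair; have : 0 < #|S i| by rewrite cS; lia.
    case/card_gt0P=> x xS; have := e x; rewrite !inE xS /=.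
    have -> : x != p by apply: contraNneq (pS i) => <-.
    by case: a b {e} => [] [].
  have [x xP [xi xj]] := indep i j ne a (~~ b).
  have := e x; rewrite !inE /= xi xj eqxx /=.
  have -> : x != p by apply: contraNneq pP => <-.
  by case: b {e xj}.
have : #|f @: setT| <= #|[set B : {set 'I_k.*2.+1} | B \subset [set~ p] & #|B| == k]|.
  apply/subset_leq_card/subsetP => _ /imsetP[[j b] _ ->]; rewrite inE.
  apply/andP; split; first by apply/subsetP => x; rewrite !inE => /andP[].
  have -> : f (j, b) = if b then S j else [set~ p] :\: S j.
    apply/setP => x; rewrite !inE /=; case: b; rewrite ?inE /=.
      by rewrite eqb_id; case: eqP => // ->; rewrite (negPf (pS j)).
    by rewrite eqbF_neg andbC.
  case: b; first by rewrite cS.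
  rewrite cardsD (setIidPr _) ?cS ?cardsC1 ?card_ord ?addnn.
    by apply/eqP; lia.
  by apply/subsetP => x xS; rewrite !inE; apply: contraNneq (pS j) => <-.
rewrite cards_draws cardsC1 card_ord card_imset // cardsT card_prod card_bool succnK.
by have := central_bin k_gt2; lia.
Qed.

(** * Moments of Gram matrices of sign vectors *)

Section SignVectors.
Import GRing.Theory Num.Theory Order.TTheory.
Local Open Scope ring_scope.

(** Lagrange's identity writes twice the difference of the sides as a sum of squares. *)
Lemma sum_cauchy_schwarz (I : finType) (a b : I -> int) :
  (\sum_i a i * b i) ^+ 2 <= (\sum_i a i ^+ 2) * (\sum_i b i ^+ 2).
Proof.
have: 0 <= \sum_i \sum_j (a i * b j - a j * b i) ^+ 2.
  by apply: sumr_ge0 => i _; apply: sumr_ge0 => j _; apply: sqr_ge0.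
have -> : \sum_i \sum_j (a i * b j - a j * b i) ^+ 2 =
  2 * ((\sum_i a i ^+ 2) * (\sum_i b i ^+ 2) - (\sum_i a i * b i) ^+ 2).
  transitivity (\sum_i \sum_j (a i ^+ 2 * b j ^+ 2) +
      \sum_i \sum_j (b i ^+ 2 * a j ^+ 2)
      - 2 * \sum_i \sum_j ((a i * b i) * (a j * b j))).
    rewrite mulr_sumr -sumrN -!big_split /=; apply: eq_bigr => i _.
    rewrite mulr_sumr -sumrN -!big_split /=; apply: eq_bigr => j _; ring.
  rewrite -!big_distrlr /=; ring.
by rewrite pmulr_rge0 // subr_ge0.
Qed.

Lemma sum_delta (I : finType) (f : I -> int) i : \sum_j (i == j)%:R * f j = f i.
Proof.
rewrite (bigD1 i) //= eqxx mul1r big1 ?addr0 // => j ne.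
by rewrite eq_sym (negPf ne) mul0r.
Qed.

Lemma sum_constz (K : finType) (c : int) : \sum_(i : K) c = c * #|K|%:R.
Proof. by rewrite sumr_const mulr_natr. Qed.

Lemma sum_affine_delta (K : finType) (F a : K -> int) c i :
  \sum_j (F j + c + (i == j)%:R * a j) = \sum_j F j + c * #|K|%:R + a i.
Proof. by rewrite !big_split /= sum_delta sum_constz. Qed.

Variables (I J : finType) (x : J -> I -> int).
Hypothesis x_sqr : forall j r, x j r ^+ 2 = 1.

(** With X the matrix of [x], [g] and [R] are the Gram matrices X X^T and X^T X, whose moments are
    compared below. *)
Let g i j := \sum_r x i r * x j r.
Let t i j l := \sum_r x i r * x j r * x l r.
Let R r s := \sum_j x j r * x j s.

Let g_diag j : g j j = #|I|%:R.
Proof. by rewrite /g (eq_bigr (fun=> 1)) ?sumr_const // => r _; rewrite -expr2. Qed.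

Let R_diag r : R r r = #|J|%:R.
Proof. by rewrite /R (eq_bigr (fun=> 1)) ?sumr_const // => j _; rewrite -expr2. Qed.

Let sum_g2 : \sum_i \sum_j g i j ^+ 2 = \sum_r \sum_s R r s ^+ 2.
Proof.
transitivity (\sum_(p : J * J) \sum_(q : I * I)
    (x p.1 q.1 * x p.2 q.1) * (x p.1 q.2 * x p.2 q.2)).
  rewrite [LHS]pair_bigA; apply: eq_bigr => p _ /=.
  by rewrite expr2 /g big_distrlr [LHS]pair_bigA.
rewrite exchange_big [RHS]pair_bigA /=; apply: eq_bigr => q _.
rewrite expr2 /R big_distrlr [RHS]pair_bigA /=; apply: eq_bigr => p _; ring.
Qed.

(** Squaring [t] gives a double sum over coordinates; summing over the triple first factors it into
    cubes of [R r s]. *)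
Let sum_t2 : \sum_i \sum_j \sum_l t i j l ^+ 2 = \sum_r \sum_s R r s ^+ 3.
Proof.
transitivity (\sum_(p : J * (J * J)) \sum_(q : I * I)
    (x p.1 q.1 * x p.2.1 q.1 * x p.2.2 q.1) * (x p.1 q.2 * x p.2.1 q.2 * x p.2.2 q.2)).
  rewrite -[RHS](pair_bigA _ (fun i (p : J * J) => \sum_(q : I * I)
    (x i q.1 * x p.1 q.1 * x p.2 q.1) * (x i q.2 * x p.1 q.2 * x p.2 q.2))) /=.
  apply: eq_bigr => i _; rewrite [LHS]pair_bigA; apply: eq_bigr => p _ /=.
  by rewrite expr2 /t big_distrlr [LHS]pair_bigA.
rewrite exchange_big [RHS]pair_bigA /=; apply: eq_bigr => q _.
rewrite exprS expr2 /R big_distrlr /= [\sum_i \sum_j _]pair_bigA big_distrlr.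
rewrite [RHS]pair_bigA /=; apply: eq_bigr => p _; ring.
Qed.

(** These are the traces of the cubes of X X^T and X^T X; their expansions agree after a cyclic
    shift of the index triple. *)
Let sum_g3 : \sum_i \sum_j \sum_l g i j * g j l * g l i =
  \sum_r \sum_s \sum_u R r s * R s u * R u r.
Proof.
have expand (K L : finType) (y : K -> L -> int) (h := fun a b => \sum_c y a c * y b c) :
   \sum_i \sum_j \sum_l h i j * h j l * h l i =
   \sum_(p : K * (K * K)) \sum_(q : L * (L * L))
     (y p.1 q.1 * y p.2.1 q.1) *
     ((y p.2.1 q.2.1 * y p.2.2 q.2.1) * (y p.2.2 q.2.2 * y p.1 q.2.2)).
  rewrite -[RHS](pair_bigA _ (fun i (p : K * K) => \sum_(q : L * (L * L))
     (y i q.1 * y p.1 q.1) *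
     ((y p.1 q.2.1 * y p.2 q.2.1) * (y p.2 q.2.2 * y i q.2.2)))) /=.
  apply: eq_bigr => i _; rewrite [LHS]pair_bigA; apply: eq_bigr => p _ /=.
  rewrite -mulrA /h [X in _ * X]big_distrlr /= [\sum_i \sum_j _]pair_bigA.
  by rewrite big_distrlr [LHS]pair_bigA.
rewrite /R (expand I J (fun r j => x j r)) /g (expand J I x) exchange_big /=.
apply: eq_bigr => q _.
rewrite (reindex (fun p : J * (J * J) => (p.2.2, (p.1, p.2.1)))) /=; last first.
  by exists (fun p => (p.2.1, (p.2.2, p.1))) => -[? []].
apply: eq_bigr => p _ /=; ring.
Qed.

Hypothesis g_off : forall i j, i != j -> g i j ^+ 2 = 4.

Let sum_R2 : \sum_r \sum_s R r s ^+ 2 =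
  #|J|%:R * #|I|%:R ^+ 2 + 4 * (#|J|%:R * (#|J|%:R - 1)).
Proof.
rewrite -sum_g2.
transitivity (\sum_(i : J) (4 * #|J|%:R + (#|I|%:R ^+ 2 - 4)) : int).
  apply: eq_bigr => i _.
  transitivity (\sum_j (4 + (i == j)%:R * (#|I|%:R ^+ 2 - 4)) : int).
    apply: eq_bigr => j _; case: eqVneq => [<-|/g_off ->]; first by rewrite g_diag mul1r addrC subrK.
    by rewrite mul0r addr0.
  by rewrite big_split /= sum_delta sum_constz.
rewrite sum_constz; ring.
Qed.

(* With [M = #|I|] and [N = #|J|], [M - 1] times the right side minus the left
   side is the sum of the squared entries of [(M - 1) R + N (E - M Id)], [E] being
   the all-ones matrix. *)
Lemma relative_bound : (1 < #|I|)%N -> (forall j, \sum_r x j r = 0) ->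
  #|I|%:R ^+ 2 * #|J|%:R ^+ 2 <=
  (#|I|%:R - 1) * (#|J|%:R * #|I|%:R ^+ 2 + 4 * (#|J|%:R * (#|J|%:R - 1))) :> int.
Proof.
move=> I_gt1 x_sum; rewrite -sum_R2.
set M : int := #|I|%:R; set N : int := #|J|%:R.
have M_gt1 : 0 < M - 1 by rewrite subr_gt0 /M ltr1n.
have R_sum r : \sum_s R r s = 0.
  rewrite /R exchange_big big1 //= => j _.
  by rewrite -mulr_sumr x_sum mulr0.
have: 0 <= \sum_r \sum_s ((M - 1) * R r s + N - (r == s)%:R * (M * N)) ^+ 2.
  by apply: sumr_ge0 => r _; apply: sumr_ge0 => s _; apply: sqr_ge0.
have -> : \sum_r \sum_s ((M - 1) * R r s + N - (r == s)%:R * (M * N)) ^+ 2 =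
   \sum_r ((M - 1) ^+ 2 * \sum_s R r s ^+ 2 - M * N ^+ 2 * (M - 1)).
  apply: eq_bigr => r _.
  transitivity (\sum_s ((M - 1) ^+ 2 * R r s ^+ 2 + N ^+ 2 + 2 * N * (M - 1) * R r s
     + (r == s)%:R * (M ^+ 2 * N ^+ 2 - 2 * M * N * ((M - 1) * R r s + N)))).
    by apply: eq_bigr => s _; case: eqVneq => _ /=; ring.
  rewrite !big_split /= sum_delta -!mulr_sumr R_sum R_diag sum_constz -/M -/N.
  ring.
rewrite sumrB -mulr_sumr sum_constz -/M.
set Q := \sum_r _.
have -> : (M - 1) ^+ 2 * Q - M * N ^+ 2 * (M - 1) * M =
  (M - 1) * ((M - 1) * Q - M ^+ 2 * N ^+ 2) by ring.
by rewrite pmulr_rge0 // subr_ge0.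
Qed.

(* Let [O] be the off-diagonal part of [R]. Counting gives [sum O^2 = 630] and, by
   the hypothesis on triples, [sum O^3 = tr O^3 - 26250] (entrywise cube on the
   left). As the entries of [O] are at least [-15], [tr O^3 >= 16800], whereas
   Cauchy-Schwarz gives [(tr O^3)^2 <= 630^3]. *)
Lemma no_fifteen_sign_vectors : #|I| = 14%N -> #|J| = 15%N ->
  (forall j, \sum_r x j r = 0) ->
  (forall i j l, i != j -> j != l -> i != l ->
     t i j l ^+ 2 = 8 + g i j * g j l * g l i) -> False.
Proof.
move=> cI cJ x_sum t_off.
have x2 j r : x j r * x j r = 1 by rewrite -expr2.
have gC i j : g i j = g j i by apply: eq_bigr => r _; rewrite mulrC.
(* The corrections make the right side vanish at coinciding indices, as [t] does: 56 + 8 - 64 for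
   two equal, 2744 + 8 - 192 - 2560 for three. *)
have t2 i j l : t i j l ^+ 2 = g i j * g j l * g l i + 8
    - 64 * ((i == j)%:R + (j == l)%:R + (i == l)%:R)
    - 2560 * ((i == j)%:R * (j == l)%:R).
  have tiij a b : t a a b = 0.
    by rewrite -(x_sum b) /t; apply: eq_bigr => r _; rewrite x2 mul1r.
  have [<-|nij] := eqVneq i j.
    rewrite tiij g_diag cI gC; have [<-|nil] := eqVneq i l.
      by rewrite g_diag cI.
    have := g_off nil; rewrite gC => gl.
    by rewrite -mulrA -expr2 gl.
  have [<-|njl] := eqVneq j l.
    have -> : t i j j = t j j i by apply: eq_bigr => r _; ring.
    rewrite tiij g_diag cI [g j i]gC (negPf nij).
    have -> : g i j * 14%:R * g i j = 14%:R * g i j ^+ 2 by ring.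
    by rewrite g_off.
  have [<-|nil] := eqVneq i l.
    have -> : t i j i = t i i j by apply: eq_bigr => r _; ring.
    rewrite tiij g_diag cI [g j i]gC.
    have -> : g i j * g i j * 14%:R = 14%:R * g i j ^+ 2 by ring.
    by rewrite g_off.
  by rewrite t_off //=; ring.
(* Summing [t2] over all triples, 3640 = 2560 + 192 * 15 - 8 * 225. *)
have R3 : \sum_r \sum_s R r s ^+ 3 = \sum_r \sum_s \sum_u R r s * R s u * R u r - 3640 * 15.
  rewrite -sum_t2 -sum_g3.
  transitivity (\sum_i (\sum_j \sum_l g i j * g j l * g l i - 3640)); last first.
    by rewrite big_split /= sum_constz cJ; ring.
  apply: eq_bigr => i _.
  transitivity (\sum_j (\sum_l g i j * g j l * g l i + - 8 + (i == j)%:R * - 3520)).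
    apply: eq_bigr => j _.
    transitivity (\sum_l (g i j * g j l * g l i + (j == l)%:R * - (64 + 2560 * (i == j)%:R)
        + (8 - 64 * (i == j)%:R) + (i == l)%:R * - 64)).
      by apply: eq_bigr => l _; rewrite t2; ring.
    by rewrite sum_affine_delta big_split /= sum_delta cJ; ring.
  by rewrite sum_affine_delta cJ; ring.
pose O r s := R r s - (r == s)%:R * 15.
have O_diag r : O r r = 0 by rewrite /O eqxx R_diag cJ.
have RC r s : R r s = R s r by apply: eq_bigr => j _; rewrite mulrC.
have OC r s : O r s = O s r by rewrite /O RC eq_sym.
have RE r s : R r s = O r s + (r == s)%:R * 15 by rewrite /O subrK.
pose q := \sum_r \sum_s O r s ^+ 2.
have qE : q = 630.
  have : \sum_r \sum_s R r s ^+ 2 = q + 225 * 14.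
    have -> : 225 * 14 = \sum_(r : I) (225 : int) by rewrite sum_constz cI.
    rewrite -big_split /=; apply: eq_bigr => r _.
    transitivity (\sum_s (O r s ^+ 2 + (r == s)%:R * (30 * O r s + 225))).
      by apply: eq_bigr => s _; rewrite RE; case: eqVneq => _ /=; ring.
    by rewrite big_split /= sum_delta O_diag.
  by rewrite sum_R2 cI cJ => e; apply: (@addIr _ (225 * 14)); rewrite -e.
pose W s r := \sum_u O s u * O u r.
pose T := \sum_r \sum_s O r s * W s r.
(* The diagonal cubes cancel, and 3640 * 15 - 45 * 630 = 1875 * 14. *)
have O3 : \sum_r \sum_s O r s ^+ 3 = T - 1875 * 14.
  have e1 : \sum_r \sum_s R r s ^+ 3 = \sum_r \sum_s O r s ^+ 3 + 3375 * 14.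
    have -> : 3375 * 14 = \sum_(r : I) (3375 : int) by rewrite sum_constz cI.
    rewrite -big_split /=; apply: eq_bigr => r _.
    transitivity (\sum_s (O r s ^+ 3 +
        (r == s)%:R * (45 * O r s ^+ 2 + 675 * O r s + 3375))).
      by apply: eq_bigr => s _; rewrite RE; case: eqVneq => _ /=; ring.
    by rewrite big_split /= sum_delta O_diag.
  have e2 : \sum_r \sum_s \sum_u R r s * R s u * R u r = T + 45 * q + 3375 * 14.
    have -> : 3375 * 14 = \sum_(r : I) (3375 : int) by rewrite sum_constz cI.
    rewrite mulr_sumr -!big_split /=; apply: eq_bigr => r _.
    transitivity (\sum_s (O r s * W s r + 30 * O r s ^+ 2 + (r == s)%:R *
        (225 * O r s + 15 * W s r + 450 * O s r + 3375))).
      apply: eq_bigr => s _.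
      have -> : \sum_u R r s * R s u * R u r = R r s * (W s r + 30 * O s r + (s == r)%:R * 225).
        transitivity (R r s * \sum_u (O s u * O u r + (s == u)%:R * (15 * O u r)
            + (r == u)%:R * (15 * O s u + (s == u)%:R * 225))).
          rewrite mulr_sumr; apply: eq_bigr => u _.
          by rewrite [R s u]RE [R u r]RE [u == r]eq_sym; ring.
        by rewrite !big_split /= !sum_delta; congr (_ * _); rewrite /W; ring.
      rewrite RE eq_sym (OC s r); case: eqVneq => _ /=; ring.
    rewrite !big_split /= sum_delta O_diag -!mulr_sumr.
    have -> : W r r = \sum_s O r s ^+ 2.
      by apply: eq_bigr => s _; rewrite (OC s) expr2.
    by ring.
  have := R3; rewrite e1 e2 qE => e; apply: (@addIr _ (3375 * 14)); rewrite e; ring.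
have O_ge r s : -15 <= O r s.
  have [<-|ne] := eqVneq r s; first by rewrite O_diag.
  rewrite /O (negPf ne) mul0r subr0 -[15]/(15%:R) -cJ -sumr_const -sumrN.
  apply: ler_sum => j _; move: (x_sqr j r) (x_sqr j s).
  by move=> /eqP + /eqP; rewrite !sqrf_eq1 => /orP[] /eqP -> /orP[] /eqP ->.
have T_ge : 1200 * 14 <= T.
  have : - 15 * q <= \sum_r \sum_s O r s ^+ 3.
    rewrite mulr_sumr; apply: ler_sum => r _; rewrite mulr_sumr; apply: ler_sum => s _.
    by have := O_ge r s; have := sqr_ge0 (O r s); rewrite exprSr; nia.
  by rewrite O3 qE; lia.
(* Cauchy-Schwarz twice: for each entry of the square of [O], then for the pairing of [O] with that
   square. Finally 16800^2 > 630^3. *)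
have T2 : T ^+ 2 <= q ^+ 3.
  have W2 : \sum_(p : I * I) W p.2 p.1 ^+ 2 <= q ^+ 2.
    have -> : q ^+ 2 = \sum_(p : I * I)
        (\sum_u O p.2 u ^+ 2) * (\sum_u O u p.1 ^+ 2).
      rewrite expr2 {2}/q exchange_big /q mulrC big_distrlr pair_bigA /=.
      by apply: eq_bigr => p _; rewrite mulrC.
    by apply: ler_sum => p _; apply: sum_cauchy_schwarz.
  have := sum_cauchy_schwarz (fun p : I * I => O p.1 p.2) (fun p => W p.2 p.1).
  rewrite -(pair_bigA _ (fun r s => O r s * W s r)) -/T.
  rewrite -(pair_bigA _ (fun r s => O r s ^+ 2)) -/q.
  move=> /le_trans; apply; rewrite [q ^+ 3]exprS; apply: ler_wpM2l W2.
  by rewrite qE.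
by move: T2; rewrite qE; nia.
Qed.

End SignVectors.

(** * From independent sets to covering arrays *)

(** Numbering the points of [D] embeds it in 2k + 1 points, where its image must be everything. *)
Lemma qualitatively_independent_in (T J : finType) k (D : {set T}) (S : J -> {set T}) :
  2 < k -> 'C(k.*2, k.-1) + 2 <= #|J| + k -> #|D| <= k.*2.+1 ->
  (forall j, S j \subset D) ->
  (forall i j, i != j -> forall a b,
     exists2 x, x \in D & (x \in S i) = a /\ (x \in S j) = b) ->
  #|D| = k.*2.+1 /\ forall j, k <= #|S j| <= k.+1.
Proof.
move=> k_gt2 leJ leD SD indep.
pose e x : 'I_k.*2.+1 := inord (index x (enum D)).
have e_inj : {in D &, injective e}.
  move=> x y xD yD /(congr1 val); rewrite /= !inordK; first last.
  - by apply: leq_trans leD; rewrite cardE index_mem mem_enum.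
  - by apply: leq_trans leD; rewrite cardE index_mem mem_enum.
  by move=> exy; rewrite -(nth_index x (s := enum D) (x := x)) ?mem_enum // exy
    nth_index ?mem_enum.
have mem_eS j x : x \in D -> (e x \in e @: S j) = (x \in S j).
  move=> xD; apply/imsetP/idP => [[y yS exy]|xS]; last by exists x.
  by rewrite (e_inj _ _ xD _ exy) // (subsetP (SD j)).
have indep' i j : i != j -> forall a b, exists2 x, x \in e @: D &
    (x \in e @: S i) = a /\ (x \in e @: S j) = b.
  move=> ne a b; have [x xD [xi xj]] := indep i j ne a b.
  by exists (e x); [apply: imset_f | rewrite !mem_eS].
split.
  rewrite -(card_in_imset e_inj) (@qualitatively_independent_setT J k (e @: D) (fun j => e @: S j)) //.
    by rewrite cardsT card_ord.
  by move=> j; apply: imsetS.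
move=> j; rewrite -(card_in_imset (f := e)) => [|x y /(subsetP (SD j)) xD /(subsetP (SD j))].
  apply: (@qualitatively_independent_card J k (fun j => e @: S j)) => // i i' ne a b.
  by have [x _ h] := indep' i i' ne a b; exists x.
exact: e_inj.
Qed.

Lemma covering_array2P m n (A : 'M[bool]_(m, n)) :
  (forall i j, i != j -> forall a b, exists r, A r i = a /\ A r j = b) ->
  covering_array 2 A.
Proof.
move=> cov; apply/forallP => c; apply/implyP => /injectiveP c_inj; apply/forallP => v.
have [|r [r0 r1]] := cov (c ord0) (c ord_max) _ (v ord0) (v ord_max).
  by rewrite (inj_eq c_inj).
apply/existsP; exists r; apply/forallP => i; apply/eqP.
have [->|->] : i = ord0 \/ i = ord_max by case: i => -[|[|]] // ?; [left | right]; apply: val_inj.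
  exact: r0.
exact: r1.
Qed.

Lemma covering_array3P m n (A : 'M[bool]_(m, n)) : covering_array 3 A ->
  forall i j l, i != j -> j != l -> i != l ->
  forall a b d, exists r, [/\ A r i = a, A r j = b & A r l = d].
Proof.
move=> /forallP cov i j l nij njl nil a b d.
pose c := [ffun p : 'I_3 => nth i [:: i; j; l] p].
pose v := [ffun p : 'I_3 => nth a [:: a; b; d] p].
have c_inj : injectiveb c.
  apply/injectiveP => p q; rewrite !ffunE => /eqP.
  by rewrite nth_uniq //= ?inE ?negb_or ?nij ?njl ?nil // => /eqP/val_inj.
have /forallP/(_ v)/existsP[r /forallP rP] := implyP (cov c) c_inj.
exists r; have := (rP (inord 0), rP (inord 1), rP (inord 2)).
by rewrite !ffunE !inordK //= => -[[/eqP -> /eqP ->] /eqP ->].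
Qed.

(** For two distinct [k]-sets through [x0], the pattern 11 occurs at [x0], 10 and 01 by equal size,
    and 00 because the union has at most 2k - 1 points. *)
Lemma CAN2_le k n : 0 < k -> n <= 'C(k.*2, k.-1) -> CAN 2 n <= k.*2.+1.
Proof.
move=> k_gt0 le_n; rewrite /CAN; case: ex_minnP => m0 _; apply.
pose x0 : 'I_k.*2.+1 := ord0.
pose U := [set B : {set 'I_k.*2.+1} | B \subset [set~ x0] & #|B| == k.-1].
have cU : n <= #|U| by rewrite cards_draws cardsC1 card_ord succnK.
pose S (j : 'I_n) := x0 |: enum_val (widen_ord cU j).
have valU j : x0 \notin enum_val (widen_ord cU j) /\ #|enum_val (widen_ord cU j)| = k.-1.
  have := enum_valP (widen_ord cU j); rewrite inE => /andP[/subsetP sub /eqP ->].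
  by split=> //; apply/negP => /sub; rewrite !inE eqxx.
have cS j : #|S j| = k by rewrite cardsU1; case: (valU j) => -> ->; lia.
have S_inj : injective S.
  move=> i j /setP e; have: widen_ord cU i = widen_ord cU j; last first.
    by move=> /(congr1 val) eij; apply: val_inj.
  apply: enum_val_inj; apply/setP => x; have := e x; rewrite !inE.
  by case: eqP => //= ->; rewrite (negPf (valU i).1) (negPf (valU j).1).
have diff i j : i != j -> exists2 x, x \in S i & x \notin S j.
  move=> ne; apply/subsetPn; apply: contra ne => sub; apply/eqP/S_inj/eqP.
  by rewrite eqEcard sub !cS leqnn.
apply/existsP; exists (\matrix_(r, j) (r \in S j))%R.
apply: covering_array2P => i j ne a b.
have [] : exists r, (r \in S i) = a /\ (r \in S j) = b; last first.
  by move=> r; exists r; rewrite !mxE.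
case: a b => [] [].
- by exists x0; rewrite !inE eqxx.
- by have [x xi /negPf xj] := diff i j ne; exists x.
- by rewrite eq_sym in ne; have [x xi /negPf xj] := diff j i ne; exists x.
have : 0 < #|~: (S i :|: S j)|.
  have := cardsC (S i :|: S j); have := cardsUI (S i) (S j); rewrite card_ord !cS.
  have : 0 < #|S i :&: S j| by apply/card_gt0P; exists x0; rewrite !inE eqxx.
  by lia.
case/card_gt0P=> x; rewrite !inE negb_or => /andP[/negPf xi /negPf xj].
by exists x; rewrite !inE xi xj.
Qed.

(** * Small 3-covering arrays as balanced sign vectors *)

Section BalancedArray.
Import GRing.Theory Num.Theory Order.TTheory.
Local Open Scope ring_scope.

Definition sign_of (b : bool) : int := 1 - 2 * b%:R.

Lemma sign_of_sqr b : sign_of b ^+ 2 = 1.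
Proof. by case: b. Qed.

Variables (k m n : nat) (A : 'M[bool]_(m, n)).
Hypotheses (k_gt2 : (2 < k)%N) (A_cov : covering_array 3 A).
Hypotheses (m_le : (m <= 2 * k.*2.+1)%N) (n_ge : ('C(k.*2, k.-1) + 2 < n + k)%N).

Let half i a := [set r | A r i == a].

(** On the rows where column [i] reads [a], 3-covering makes the other [n - 1] columns qualitatively
    independent. *)
Let halfP i a : (#|half i a| <= k.*2.+1)%N -> #|half i a| = k.*2.+1 /\
  forall j, j != i -> (k <= #|[set r | (A r i == a) && A r j]| <= k.+1)%N.
Proof.
move=> le_half; pose S (j : {j | j != i}) := [set r | (A r i == a) && A r (val j)].
have [|j|j l ne b d|cD cS] := @qualitatively_independent_in _ _ k (half i a) S k_gt2 _ le_half.
- by rewrite card_sig (eq_card (B := predC1 i)) // cardC1 card_ord; lia.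
- by apply/subsetP => r; rewrite !inE => /andP[].
- have nil : val l != i by apply: valP l.
  have [|||r [rj ri rl]] := covering_array3P A_cov (i := val j) (j := i) (l := val l) _ _ _ b a d.
  + exact: valP j.
  + by rewrite eq_sym.
  + by rewrite (inj_eq val_inj).
  exists r; first by rewrite inE ri.
  by rewrite !inE ri eqxx rj rl.
by split=> // j ne; apply: (cS (exist _ j ne)).
Qed.

Let card_halfs i : (#|half i true| + #|half i false|)%N = m.
Proof.
rewrite -[RHS]card_ord -(cardsC (half i true)); congr addn; apply: eq_card => r.
by rewrite !inE; case: (A r i).
Qed.

(** By [halfP] neither half is smaller, and together they have at most twice as many rows. *)
Let card_half i a : #|half i a| = k.*2.+1.
Proof.
have ge b : (k.*2.+1 <= #|half i b|)%N.
  by rewrite leqNgt; apply/negP => lt; have [e] := halfP (ltnW lt); rewrite e ltnn in lt.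
have := card_halfs i; have := ge true; have := ge false; move: m_le.
by case: a; lia.
Qed.

Lemma balanced_array_size : m = (2 * k.*2.+1)%N.
Proof.
have n_gt0 : (0 < n)%N by have := @leq_bin k.*2 k.-1; lia.
by rewrite -(card_halfs (Ordinal n_gt0)) !card_half; lia.
Qed.

Let x j r := sign_of (A r j).

Lemma balanced_array_sum j : \sum_r x j r = 0.
Proof.
rewrite sumrB sumr_const card_ord -mulr_sumr -natr_sum -big_mkcond sum1dep_card.
rewrite (eq_card (B := half j true)) => [|r]; last by rewrite !inE eqb_id.
by rewrite card_half balanced_array_size; lia.
Qed.

(** For balanced columns the inner product is 4c - m, with [c] the number of common ones; here m =
    4k + 2 and [c] is k or k + 1. *)
Lemma balanced_array_product i j : i != j -> (\sum_r x i r * x j r) ^+ 2 = 4.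
Proof.
rewrite eq_sym => ne; have [|_ /(_ _ ne) cij] := @halfP i true.
  by rewrite card_half.
have -> : \sum_r x i r * x j r =
    4 * #|[set r | (A r i == true) && A r j]|%:R - \sum_(r < m) 1 + \sum_r x i r + \sum_r x j r.
  have -> : #|[set r | (A r i == true) && A r j]|%:R =
      \sum_(r < m) ((A r i == true) && A r j)%:R :> int.
    by rewrite -sum1dep_card natr_sum [LHS]big_mkcond; apply: eq_bigr => r _; case: (_ && _).
  rewrite mulr_sumr -sumrB -!big_split /=.
  by apply: eq_bigr => r _; rewrite /x; case: (A r i) (A r j) => [] [].
rewrite !balanced_array_sum sumr_const card_ord.
move: #|[set r | (A r i == true) && A r j]| cij => c cij; rewrite balanced_array_size.
have [->|->] : c = k \/ c = k.+1 by lia.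
  by have -> : 4 * k%:R - (2 * k.*2.+1)%:R + 0 + 0 = -2 :> int by lia.
by have -> : 4 * k.+1%:R - (2 * k.*2.+1)%:R + 0 + 0 = 2 :> int by lia.
Qed.

(* The left side is eight times the number of rows that read [a b d] in the
   columns [i], [j], [l]. *)
Lemma balanced_array_triple i j l a b d : i != j -> j != l -> i != l ->
  exists2 c : int, 1 <= c &
  m%:R + sign_of a * sign_of b * (\sum_r x i r * x j r)
    + sign_of b * sign_of d * (\sum_r x j r * x l r)
    + sign_of d * sign_of a * (\sum_r x l r * x i r)
    + sign_of a * sign_of b * sign_of d * (\sum_r x i r * x j r * x l r) = 8 * c.
Proof.
move=> nij njl nil; have [r0 [ri rj rl]] := covering_array3P A_cov nij njl nil a b d.
exists (\sum_r [&& A r i == a, A r j == b & A r l == d]%:R).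
  rewrite (bigD1 r0) //= ri rj rl !eqxx lerDl.
  by apply: sumr_ge0 => r _; rewrite ler0n.
(* The vanishing linear sums complete the product of [1 + sign_of a * x i r] and its two analogues,
   which is 8 on the counted rows and 0 elsewhere. *)
have -> : m%:R = \sum_(r < m) 1 + sign_of a * (\sum_r x i r)
    + sign_of b * (\sum_r x j r) + sign_of d * (\sum_r x l r).
  by rewrite !balanced_array_sum sumr_const card_ord; ring.
rewrite !mulr_sumr -!big_split /=; apply: eq_bigr => r _; rewrite /x.
by case: a b d (A r i) (A r j) (A r l) {r0 ri rj rl} => [] [] [] [] [] [].
Qed.

(** Negating all three signs flips only the triple term t. If the inner products multiply to 8, some
    signs give 12 + t and 12 - t, multiples of 8 that are at least 8, so t is 4 or -4. If they
    multiply to -8, some give 8 + t and 8 - t, so t = 0. *)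
Lemma balanced_array_triple_sqr i j l : k = 3 -> i != j -> j != l -> i != l ->
  (\sum_r x i r * x j r * x l r) ^+ 2 =
  8 + (\sum_r x i r * x j r) * (\sum_r x j r * x l r) * (\sum_r x l r * x i r).
Proof.
move=> k3 nij njl nil.
have cell a b d := balanced_array_triple a b d nij njl nil.
have sqrt4 (y : int) : y ^+ 2 = 4 -> y = 2 \/ y = -2.
  move=> /eqP; rewrite (_ : 4 = 2 ^+ 2) // eqf_sqr => /orP[] /eqP ->; [by left | by right].
have m14 : m%:R = 14 :> int by rewrite balanced_array_size k3.
have g1 := sqrt4 _ (balanced_array_product nij).
have g2 := sqrt4 _ (balanced_array_product njl).
rewrite eq_sym in nil; have g3 := sqrt4 _ (balanced_array_product nil).
move: cell g1 g2 g3; rewrite m14.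
move: (\sum_r _) (\sum_r _) (\sum_r _) (\sum_r _) => t g1 g2 g3 cell.
move: (cell true true true) (cell true true false) (cell true false true) (cell true false false).
move: (cell false true true) (cell false true false) (cell false false true) (cell false false false).
rewrite /sign_of => -[c1 ? ?] [c2 ? ?] [c3 ? ?] [c4 ? ?] [c5 ? ?] [c6 ? ?] [c7 ? ?] [c8 ? ?].
move=> [] e1 [] e2 [] e3.
all: have : t = 4 \/ t = -4 \/ t = 0 by lia.
all: by move=> [e|[e|e]]; subst; lia.
Qed.

End BalancedArray.

(** * Excluding arrays with at most 2m rows *)

(** Pascal's rule twice leaves four binomials, each at least 2k - 2. This yields 4k + 6 columns,
    just above the limit 4k + 5 + 1/k of the relative bound. *)
Lemma central_bin_ge k : 3 < k -> 5 * k + 3 <= 'C(k.*2, k.-1).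
Proof.
case: k => [|[|[|k]]] // k_gt0; have -> : k.+3.*2 = (k.*2.+4).+2 by lia.
rewrite [k.+3.-1]/= !(binS k.*2.+4.+1) !(binS k.*2.+4).
have := @leq_bin k.*2.+4 k.+2; have := @leq_bin k.*2.+4 k.+1.
by have := @leq_bin k.*2.+4 k; lia.
Qed.

(* [relative_bound] suffices for [k > 3] only; for [k = 3] it allows 17 columns. *)
Lemma covering_array3_size k m n (A : 'M[bool]_(m, n)) :
  2 < k -> covering_array 3 A -> 'C(k.*2, k.-1) + 2 < n + k ->
  2 * k.*2.+1 < m.
Proof.
move=> k_gt2 A_cov n_ge; rewrite ltnNge; apply/negP => m_le.
have mE := balanced_array_size k_gt2 A_cov m_le n_ge.
have x_sqr (j : 'I_n) (r : 'I_m) : (sign_of (A r j) ^+ 2 = 1)%R by apply: sign_of_sqr.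
have x_sum := balanced_array_sum k_gt2 A_cov m_le n_ge.
have x_off := balanced_array_product k_gt2 A_cov m_le n_ge.
have [k_gt3|k_le3] := ltnP 3 k.
  have := relative_bound x_sqr x_off _ x_sum; rewrite !card_ord mE => /(_ ltac:(lia)).
  have [e ->] : exists e, n = 4 * k + 6 + e.
    by have := central_bin_ge k_gt3; exists (n - (4 * k + 6)); lia.
  pose K : int := Posz k; pose N : int := (4 * K + 6 + Posz e)%R.
  have -> : ((2 * k.*2.+1)%:R = 4 * K + 2 :> int)%R by rewrite /K; lia.
  have -> : ((4 * k + 6 + e)%:R = N :> int)%R by rewrite /N /K; lia.
  apply/negP; rewrite -Order.TotalTheory.ltNge -Num.Theory.subr_gt0.
  have -> : ((4 * K + 2) ^+ 2 * N ^+ 2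
      - (4 * K + 2 - 1) * (N * (4 * K + 2) ^+ 2 + 4 * (N * (N - 1)))
      = N * (16 * K) * ((K - 1) + K * Posz e))%R by rewrite /N; ring.
  by apply: Num.Theory.mulr_gt0; first apply: Num.Theory.mulr_gt0; rewrite /N /K; nia.
have k3 : k = 3 by lia.
have n15 : 15 <= n by move: n_ge; rewrite k3 (_ : 'C(3.*2, 3.-1) = 15) //; lia.
pose w := widen_ord n15.
have w_inj : injective w by move=> i j /(congr1 val) e; apply: val_inj.
have w_neq i j : i != j -> w i != w j by rewrite (inj_eq w_inj).
apply: (@no_fifteen_sign_vectors _ _ (fun j r => sign_of (A r (w j)))).
- by move=> j r; apply: x_sqr.
- by move=> i j /w_neq; apply: x_off.
- by rewrite card_ord mE k3.
- by rewrite card_ord.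
- by move=> j; apply: x_sum.
move=> i j l /w_neq nij /w_neq njl /w_neq nil.
exact: balanced_array_triple_sqr k3 nij njl nil.
Qed.

Theorem theorem4p7 (m n : nat) (hm : 7 <= m) (hodd : odd m)
  (hlo : 'C(m - 1, m %/ 2 - 1) + m - 3 * (m %/ 2) < n)
  (hhi : n <= 'C(m - 1, m %/ 2 - 1)) :
  2 * CAN 2 n + 1 <= CAN 3 (n + 1).
Proof.
pose k := m %/ 2.
have mE : m = k.*2.+1 by rewrite /k; lia.
have k_gt2 : 2 < k by lia.
have binE : 'C(m - 1, m %/ 2 - 1) = 'C(k.*2, k.-1) by rewrite {1}mE !subn1.
have le2 : CAN 2 n <= k.*2.+1 by apply: CAN2_le; [lia | rewrite -binE].
have lt3 : 2 * k.*2.+1 < CAN 3 (n + 1).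
  rewrite /CAN; case: ex_minnP => m3 /existsP[A A_cov] _.
  apply: covering_array3_size k_gt2 A_cov _.
  (* Since m - 3k = 1 - k, [hlo] gives C(2k, k-1) + 2 < (n + 1) + k. *)
  by have := @leq_bin k.*2 k.-1; move: hlo; rewrite binE -/k; lia.
lia.
Qed.
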